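(* For every $n\geq 2$ the commutator subgroup $A_{A_n}'$ of the Artin group $A_{A_n}$ is a finitely presented group. More precisely: (i) $A_{A_2}'$ is a free group with two free generators $p_0=a_2a_1^{-1}$, $p_1=a_1a_2a_1^{-2}$. (ii) $A_{A_3}'$ is the group generated by $p_0=a_2a_1^{-1}$, $p_1=a_1a_2a_1^{-2}$, $q=a_3a_1^{-1}$, $b=a_2a_1^{-1}a_3a_2^{-1}$, with defining relations $$b=p_0qp_0^{-1},\quad p_0bp_0^{-1}=b^2q^{-1}b,\quad p_1qp_1^{-1}=q^{-1}b,\quad p_1bp_1^{-1}=(q^{-1}b)^3q^{-2}b.$$ (iii) For $n\geq 4$ the group $A_{A_n}'$ is generated by $p_0=a_2a_1^{-1}$, $p_1=a_1a_2a_1^{-2}$, $q_3=a_3a_1^{-1}$, $b=a_2a_1^{-1}a_3a_2^{-1}$, $q_\ell=a_\ell a_1^{-1}$ ($4\le \ell\le n$), with defining relations $$b=p_0q_3p_0^{-1},\quad p_0bp_0^{-1}=b^2q_3^{-1}b,\quad p_1q_3p_1^{-1}=q_3^{-1}b,\quad p_1bp_1^{-1}=(q_3^{-1}b)^3q_3^{-2}b,$$ $$p_0q_i=q_ip_1\ (4\le i\le n),\quad p_1q_i=q_ip_0^{-1}p_1\ (4\le i\le n),$$ $$q_3q_i=q_iq_3\ (5\le i\le n),\quad q_3q_4q_3=q_4q_3q_4,$$ $$q_iq_j=q_jq_i\ (4\le i<j-1\le n-1),\quad q_iq_{i+1}q_i=q_{i+1}q_iq_{i+1}\ (4\le i\le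 n-1).$$
   Context: $A_{A_n}$ is the Artin group of type $A_n$ (the braid group on $n+1$ strings): generators $a_1,\dots,a_n$ and relations $a_ia_j=a_ja_i$ for $|i-j|\ge2$, $a_ia_{i+1}a_i=a_{i+1}a_ia_{i+1}$ for $1\le i\le n-1$. $G'$ denotes the commutator subgroup of $G$. ''The group $A_{A_n}'$ is generated by the listed elements with the listed defining relations'' means that the listed elements lie in $A_{A_n}'$ and that the obvious map from the abstract group with that presentation to $A_{A_n}'$ is an isomorphism. Indices of the generators $q_\ell$ in the relations range only over those for which a generator is listed. *)

(* Defs.v *)
From HB Require Import structures.
From mathcomp Require Import all_boot generic_quotient.
From mathcomp Require Import boolp classical_sets.

Set Implicit Arguments.
Unset Strict Implicit.
Unset Printing Implicit Defensive.

Local Open Scope classical_set_scope.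
Local Open Scope group_scope.

(* A letter is (x, false) for x or (x, true) for x^-1. *)
Definition letter (X : Type) : Type := (X * bool)%type.

Definition flip (X : Type) (l : letter X) : letter X := (l.1, ~~ l.2).

Lemma flipK (X : Type) : involutive (@flip X).
Proof. by case=> x b; rewrite /flip /= negbK. Qed.

Definition reduced (X : choiceType) : pred (seq (letter X)) :=
  sorted (fun l m => m != flip l).

Definition cons_reduce (X : choiceType) (l : letter X) (w : seq (letter X)) :=
  if w is m :: w' then if m == flip l then w' else l :: w else [:: l].

Definition concat_reduce (X : choiceType) (u v : seq (letter X)) :=
  foldr (@cons_reduce X) v u.

Definition inv_word (X : Type) (w : seq (letter X)) := rev (map (@flip X) w).

Record free_group (X : choiceType) :=
  FreeGroup { fg_word : seq (letter X); _ : reduced fg_word }.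

HB.instance Definition _ (X : choiceType) := [isSub for @fg_word X].
HB.instance Definition _ (X : choiceType) := [Choice of free_group X by <:].

Section FreeGroupTheory.
Variable X : choiceType.
Implicit Types (l : letter X) (u v w : seq (letter X)).

Lemma reduced_behead l w : reduced (l :: w) -> reduced w.
Proof. exact: path_sorted. Qed.

Lemma cons_reduceP l w : reduced w -> reduced (cons_reduce l w).
Proof.
case: w => [//|m w] Rw /=; case: ifP => [_|mNl]; first exact: reduced_behead Rw.
by rewrite /reduced /= mNl; exact: Rw.
Qed.

Lemma concat_reduceP u v : reduced v -> reduced (concat_reduce u v).
Proof. by move=> Rv; elim: u => [//|l u IHu]; exact: cons_reduceP. Qed.

Lemma cons_reduceK l w : reduced w -> cons_reduce l (cons_reduce (flip l) w) = w.
Proof.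
case: w => [_|m w] /=; first by rewrite eqxx.
rewrite flipK; case: (eqVneq m l) => [->|mNl _] /=; last by rewrite eqxx.
by case: w => [//|k w] /andP[kNl _] /=; rewrite (negbTE kNl).
Qed.

Lemma reduced_cons_reduce l w : reduced (l :: w) -> cons_reduce l w = l :: w.
Proof. by case: w => [//|m w] /andP[mNl _] /=; rewrite (negbTE mNl). Qed.

Lemma concat_reduce_cons l u v : reduced v ->
  concat_reduce (cons_reduce l u) v = cons_reduce l (concat_reduce u v).
Proof.
case: u => [//|m u] Rv /=; case: eqP => [->|//].
by rewrite cons_reduceK //; exact: concat_reduceP.
Qed.

Lemma concat_reduceA u v w : reduced w ->
  concat_reduce u (concat_reduce v w) = concat_reduce (concat_reduce u v) w.
Proof. by move=> Rw; elim: u => [//|l u /= ->]; rewrite concat_reduce_cons. Qed.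

Lemma concat_reduce0 u : reduced u -> concat_reduce u [::] = u.
Proof.
elim: u => [//|l u IHu] Rlu; rewrite /= IHu; last exact: reduced_behead Rlu.
exact: reduced_cons_reduce.
Qed.

Lemma inv_word_cons l w : inv_word (l :: w) = rcons (inv_word w) (flip l).
Proof. by rewrite /inv_word /= rev_cons. Qed.

Lemma inv_wordK : involutive (@inv_word X).
Proof.
move=> w; rewrite /inv_word map_rev revK mapK //; exact: flipK.
Qed.

Lemma concat_reduce_rcons u l v :
  concat_reduce (rcons u l) v = concat_reduce u (cons_reduce l v).
Proof. by rewrite /concat_reduce foldr_rcons. Qed.

Lemma concat_reduceVw w : reduced w -> concat_reduce (inv_word w) w = [::].
Proof.
elim: w => [//|l w IHw] Rlw; rewrite inv_word_cons concat_reduce_rcons /=.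
by rewrite flipK eqxx IHw //; exact: reduced_behead Rlw.
Qed.

Lemma reduced_inv w : reduced w -> reduced (inv_word w).
Proof.
rewrite /reduced /inv_word rev_sorted sorted_map; apply: sub_sorted => l m /=.
by rewrite /= flipK eq_sym.
Qed.

Definition fg_one : free_group X := @FreeGroup X [::] isT.
Definition fg_mul (x y : free_group X) : free_group X :=
  FreeGroup (concat_reduceP (fg_word x) (valP y)).
Definition fg_inv (x : free_group X) : free_group X :=
  FreeGroup (reduced_inv (valP x)).

Fact fg_mulA : associative fg_mul.
Proof.
by move=> x y z; apply/val_inj; rewrite /= concat_reduceA //; exact: (valP z).
Qed.
Fact fg_mul1 : left_id fg_one fg_mul.
Proof. by move=> x; apply/val_inj. Qed.
Fact fg_mulr1 : right_id fg_one fg_mul.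
Proof. by move=> x; apply/val_inj; exact: concat_reduce0 (valP x). Qed.
Fact fg_mulV : left_inverse fg_one fg_inv fg_mul.
Proof. by move=> x; apply/val_inj; exact: concat_reduceVw (valP x). Qed.
Fact fg_mulrV : right_inverse fg_one fg_inv fg_mul.
Proof.
move=> x; apply/val_inj; rewrite /= -{1}[fg_word x]inv_wordK.
by apply: concat_reduceVw; apply: reduced_inv (valP x).
Qed.

HB.instance Definition _ := isGroup.Build (free_group X)
  fg_mulA fg_mul1 fg_mulr1 fg_mulV fg_mulrV.

Definition fg_gen (x : X) : free_group X := @FreeGroup X [:: (x, false)] isT.

End FreeGroupTheory.

Definition is_subgroup (G : groupType) (H : set G) : Prop :=
  group_closed (mem H).

Definition is_normal_subgroup (G : groupType) (N : set G) : Prop :=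
  is_subgroup N /\ forall x g : G, N x -> N (x ^ g).

Definition normal_closure (G : groupType) (S : set G) : set G :=
  smallest (@is_normal_subgroup G) S.

(* <X | R>: the quotient of the free group on X by the normal closure of the
   elements u v^-1, where R u v stands for the relation u = v. *)
Section Presented.
Variables (X : choiceType) (R : free_group X -> free_group X -> Prop).
Local Notation F := (free_group X).

Definition relators : set F := [set w | exists u v : F, R u v /\ w = u / v].

Lemma normal_closure_normal (S : set F) : is_normal_subgroup (normal_closure S).
Proof.
split; first split.
- by apply/mem_set => N [[[N1 _] _] _]; apply/set_mem.
- move=> x y /set_mem Sx /set_mem Sy; apply/mem_set => N NN.
  apply/set_mem; apply: (NN.1.1.2); apply/mem_set; [exact: Sx|exact: Sy].
- by move=> x g Sx N NN; apply: (NN.1.2); exact: Sx.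
Qed.

Definition pres_eq : rel F := fun u v => `[< normal_closure relators (u / v) >].

Let ncl1 : normal_closure relators 1.
Proof. by apply/set_mem; case: (normal_closure_normal relators) => -[]. Qed.

Let nclF x y : normal_closure relators x -> normal_closure relators y ->
  normal_closure relators (x / y).
Proof.
have [[_ ncl_div] _] := normal_closure_normal relators.
by move=> /mem_set Rx /mem_set Ry; exact/set_mem/(ncl_div x y).
Qed.

Let nclV x : normal_closure relators x -> normal_closure relators x^-1.
Proof. by move=> /(nclF ncl1); rewrite mul1g. Qed.

Let nclM x y : normal_closure relators x -> normal_closure relators y ->
  normal_closure relators (x * y).
Proof. by move=> Rx /nclV /(nclF Rx); rewrite invgK. Qed.

Let nclJ x g : normal_closure relators x -> normal_closure relators (x ^ g).
Proof. exact: (normal_closure_normal relators).2. Qed.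

Fact pres_eq_refl : reflexive pres_eq.
Proof. by move=> u; apply/asboolP; rewrite mulgV. Qed.
Fact pres_eq_sym : symmetric pres_eq.
Proof.
by move=> u v; apply/asboolP/asboolP => /nclV; rewrite invgM invgK.
Qed.
Fact pres_eq_trans : transitive pres_eq.
Proof.
move=> v u w /asboolP uv /asboolP vw; apply/asboolP.
by have := nclM uv vw; rewrite mulgA mulgVK.
Qed.

Canonical pres_equiv := EquivRel pres_eq pres_eq_refl pres_eq_sym pres_eq_trans.

Definition presented := {eq_quot pres_equiv}%qT.
HB.instance Definition _ := Choice.on presented.

Definition pres_pi (u : F) : presented := \pi_presented%qT u.

Lemma pres_piP u v : pres_pi u = pres_pi v <-> normal_closure relators (u / v).
Proof.
split=> [/eqmodP/asboolP //|Ruv].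
by apply/eqmodP/asboolP.
Qed.

Lemma pres_piK (x : presented) : pres_pi (repr x) = x.
Proof. exact: reprK. Qed.

Definition pres_one : presented := pres_pi 1.
Definition pres_mul (x y : presented) : presented := pres_pi (repr x * repr y).
Definition pres_inv (x : presented) : presented := pres_pi (repr x)^-1.

Fact pres_piM u v : pres_pi (u * v) = pres_mul (pres_pi u) (pres_pi v).
Proof.
have /pres_piP Ru := esym (pres_piK (pres_pi u)).
have /pres_piP Rv := esym (pres_piK (pres_pi v)).
apply/pres_piP; rewrite invgM; set u' := repr _ in Ru *; set v' := repr _ in Rv *.
have -> : u * v * (v'^-1 * u'^-1) = (v / v') ^ u^-1 * (u / u').
  by rewrite /conjg invgK -!mulgA mulKg.
exact: nclM (nclJ _ Rv) Ru.
Qed.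

Fact pres_piV u : pres_pi u^-1 = pres_inv (pres_pi u).
Proof.
have /pres_piP Ru := esym (pres_piK (pres_pi u)).
apply/pres_piP; rewrite invgK; set u' := repr _ in Ru *.
have -> : u^-1 * u' = ((u / u') ^ u)^-1.
  by rewrite /conjg !invgM !invgK -!mulgA mulVg mulg1.
exact: nclV (nclJ _ Ru).
Qed.

Fact pres_mulA : associative pres_mul.
Proof.
move=> x y z; rewrite -(pres_piK x) -(pres_piK y) -(pres_piK z).
by rewrite -!pres_piM mulgA.
Qed.
Fact pres_mul1 : left_id pres_one pres_mul.
Proof. by move=> x; rewrite -(pres_piK x) -pres_piM mul1g. Qed.
Fact pres_mulr1 : right_id pres_one pres_mul.
Proof. by move=> x; rewrite -(pres_piK x) -pres_piM mulg1. Qed.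
Fact pres_mulV : left_inverse pres_one pres_inv pres_mul.
Proof. by move=> x; rewrite -(pres_piK x) -pres_piV -pres_piM mulVg. Qed.
Fact pres_mulrV : right_inverse pres_one pres_inv pres_mul.
Proof. by move=> x; rewrite -(pres_piK x) -pres_piV -pres_piM mulgV. Qed.

HB.instance Definition _ := isGroup.Build presented
  pres_mulA pres_mul1 pres_mulr1 pres_mulV pres_mulrV.
HB.instance Definition _ := isMultiplicative.Build F presented pres_pi pres_piM.

Definition pres_gen (x : X) : presented := pres_pi (fg_gen x).

End Presented.

Definition free_on (X : choiceType) (G : groupType) (f : X -> G) : Prop :=
  exists phi : {multiplicative free_group X -> G},
    bijective phi /\ forall x, phi (fg_gen x) = f x.

Definition presented_by (X : choiceType) (R : free_group X -> free_group X -> Prop)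
    (G : groupType) (f : X -> G) : Prop :=
  exists phi : {multiplicative presented R -> G},
    bijective phi /\ forall x, phi (pres_gen R x) = f x.

Definition finitely_presented (G : groupType) : Prop :=
  exists (X : finType) (rels : seq (free_group X * free_group X)) (f : X -> G),
    presented_by (fun u v => (u, v) \in rels) f.

Definition commutators (G : groupType) : set G :=
  [set c | exists x y : G, c = [~ x, y]].
Arguments commutators : clear implicits.

Definition derived_subgroup (G : groupType) : set G :=
  smallest (@is_subgroup G) (commutators G).
Arguments derived_subgroup : clear implicits.

Lemma derived_subgroup_closed (G : groupType) :
  group_closed [pred x : G | `[< derived_subgroup G x >]].
Proof.
split=> [|x y /asboolP Gx /asboolP Gy]; apply/asboolP => H [sH sCH].
  exact/set_mem/sH.1.
by apply/set_mem; apply: sH.2; apply/mem_set; [apply: Gx|apply: Gy].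
Qed.

Record commutator_group (G : groupType) := CommutatorGroup {
  cg_val :> G; _ : `[< derived_subgroup G cg_val >] }.

HB.instance Definition _ (G : groupType) := [isSub for @cg_val G].
HB.instance Definition _ (G : groupType) := [Choice of commutator_group G by <:].
HB.instance Definition _ (G : groupType) :=
  SubChoice_isSubGroup.Build G _ (commutator_group G) (derived_subgroup_closed G).

Record irange (m n : nat) := IRange { irange_val :> nat; _ : m <= irange_val <= n }.

HB.instance Definition _ m n := [isSub for @irange_val m n].
HB.instance Definition _ m n := [Countable of irange m n by <:].

Fact irange_pcan m n : pcancel (fun i : irange m n => inord i : 'I_n.+1)
  (fun k : 'I_n.+1 => insub (val k)).
Proof.
by move=> [i /= mn]; rewrite inordK ?insubT ?ltnS //; case/andP: mn.
Qed.
HB.instance Definition _ m n := isFinite.Build (irange m n) (pcan_enumP (@irange_pcan m n)).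

(* The family g with its index read as an integer; the value outside [m, n] is
   the junk value 1. *)
Definition at_index (m n : nat) (G : groupType) (g : irange m n -> G) (i : nat) : G :=
  if insub i is Some k then g k else 1.

Lemma at_indexE m n (G : groupType) (g : irange m n -> G) (i : irange m n) :
  at_index g i = g i.
Proof. by rewrite /at_index valK. Qed.

Inductive artinA_rel (n : nat) :
    free_group (irange 1 n) -> free_group (irange 1 n) -> Prop :=
| artinA_comm (i j : irange 1 n) : (i.+2 <= j) || (j.+2 <= i) ->
    artinA_rel (fg_gen i * fg_gen j) (fg_gen j * fg_gen i)
| artinA_braid (i j : irange 1 n) : j = i.+1 :> nat ->
    artinA_rel (fg_gen i * fg_gen j * fg_gen i) (fg_gen j * fg_gen i * fg_gen j).

Definition artinA (n : nat) : groupType := presented (@artinA_rel n).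

Definition artinA_gen (n i : nat) : artinA n :=
  at_index (pres_gen (@artinA_rel n)) i.

Inductive gens2 := P0_2 | P1_2.

Definition gens2_code (x : gens2) : 'I_2 := if x is P0_2 then inord 0 else inord 1.
Definition gens2_decode (i : 'I_2) : gens2 := if i == 0 :> nat then P0_2 else P1_2.
Fact gens2_codeK : cancel gens2_code gens2_decode.
Proof. by case; rewrite /gens2_decode /= inordK. Qed.
HB.instance Definition _ := Finite.copy gens2 (can_type gens2_codeK).

Inductive gens3 := P0_3 | P1_3 | Q_3 | B_3.

Definition gens3_code (x : gens3) : 'I_4 :=
  match x with P0_3 => inord 0 | P1_3 => inord 1 | Q_3 => inord 2 | B_3 => inord 3 end.
Definition gens3_decode (i : 'I_4) : gens3 :=
  nth P0_3 [:: P0_3; P1_3; Q_3; B_3] i.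
Fact gens3_codeK : cancel gens3_code gens3_decode.
Proof. by case; rewrite /gens3_decode /= inordK. Qed.
HB.instance Definition _ := Finite.copy gens3 (can_type gens3_codeK).

Section Rel3.
Local Notation p0 := (fg_gen P0_3).
Local Notation p1 := (fg_gen P1_3).
Local Notation q := (fg_gen Q_3).
Local Notation b := (fg_gen B_3).

Inductive rel3 : free_group gens3 -> free_group gens3 -> Prop :=
| rel3_b : rel3 b (p0 * q * p0^-1)
| rel3_p0b : rel3 (p0 * b * p0^-1) (b ^+ 2 * q^-1 * b)
| rel3_p1q : rel3 (p1 * q * p1^-1) (q^-1 * b)
| rel3_p1b : rel3 (p1 * b * p1^-1) ((q^-1 * b) ^+ 3 * q ^- 2 * b).

End Rel3.

Inductive gens (n : nat) := P0 | P1 | B | Q of irange 3 n.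

Definition gens_code n (x : gens n) : 'I_3 + irange 3 n :=
  match x with
  | P0 => inl (inord 0) | P1 => inl (inord 1) | B => inl (inord 2)
  | Q l => inr l
  end.
Definition gens_decode n (x : 'I_3 + irange 3 n) : gens n :=
  match x with
  | inl i => nth (P0 n) [:: P0 n; P1 n; B n] i
  | inr l => Q l
  end.
Fact gens_codeK n : cancel (@gens_code n) (@gens_decode n).
Proof. by case=> //=; rewrite inordK. Qed.
HB.instance Definition _ n := Finite.copy (gens n) (can_type (@gens_codeK n)).

Section RelN.
Variable n : nat.
Local Notation p0 := (fg_gen (P0 n)).
Local Notation p1 := (fg_gen (P1 n)).
Local Notation b := (fg_gen (B n)).
Local Notation q := (at_index (fun l : irange 3 n => fg_gen (Q l))).

Inductive relN : free_group (gens n) -> free_group (gens n) -> Prop :=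
| relN_b : relN b (p0 * q 3 * p0^-1)
| relN_p0b : relN (p0 * b * p0^-1) (b ^+ 2 * (q 3)^-1 * b)
| relN_p1q : relN (p1 * q 3 * p1^-1) ((q 3)^-1 * b)
| relN_p1b : relN (p1 * b * p1^-1) (((q 3)^-1 * b) ^+ 3 * (q 3) ^- 2 * b)
| relN_p0q i : 4 <= i <= n -> relN (p0 * q i) (q i * p1)
| relN_p1qi i : 4 <= i <= n -> relN (p1 * q i) (q i * p0^-1 * p1)
| relN_q3q i : 5 <= i <= n -> relN (q 3 * q i) (q i * q 3)
| relN_q34 : relN (q 3 * q 4 * q 3) (q 4 * q 3 * q 4)
| relN_comm i j : 4 <= i < j.-1 -> j.-1 <= n.-1 -> relN (q i * q j) (q j * q i)
| relN_braid i : 4 <= i <= n.-1 ->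
    relN (q i * q i.+1 * q i) (q i.+1 * q i * q i.+1).

End RelN.

(* Main.v *)
(* Let K be the presented group. Conjugation by a_1 should act on K by
   s : p_0 |-> p_1 |-> p_0^-1 p_1, b |-> q_3^-1 b, q_i |-> q_i; the relations are
   preserved by s and by its inverse, so s is an automorphism of K. They also
   hold in the Artin group A, which yields h : K -> A with
   h(s(x)) = a_1 h(x) a_1^-1. Conversely A acts on the set K, a_i sending x to
   q_i s(x) (with q_1 = 1 and q_2 = p_0), and through h an element x of K acts
   by left multiplication by x; hence h is injective. If D : A -> A sends every
   generator to a_1, then h(y . x) = y h(x) D(y)^-1 for all y in A; as the image
   of D is cyclic, D kills A', and x = 1 shows that every y in A' is h(y . 1). *)

From HB Require Import structures.
Require Import Defs.
From mathcomp Require Import all_boot.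
From mathcomp Require Import boolp classical_sets.
From mathcomp Require Import zify.

Set Implicit Arguments.
Unset Strict Implicit.
Unset Printing Implicit Defensive.

Local Open Scope group_scope.

(** * Homomorphisms, and the universal properties of free and presented groups *)

Section Morphisms.
Variables (G H : groupType) (f : {multiplicative G -> H}).

Lemma hom1 : f 1 = 1.
Proof. by apply: (@mulgI _ (f 1)); rewrite -gmulfM !mulg1. Qed.

Lemma homV x : f x^-1 = (f x)^-1.
Proof. by apply/esym/mulg1_eq; rewrite -gmulfM mulgV hom1. Qed.

Lemma homX x n : f (x ^+ n) = f x ^+ n.
Proof. by elim: n => [|n IHn]; rewrite ?hom1 // !expgS gmulfM IHn. Qed.

Definition homE := (hom1, @gmulfM _ _ f, homV, homX).

End Morphisms.

Definition subgroup_pred (G : groupType) (P : G -> Prop) : Prop :=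
  [/\ P 1, forall x y, P x -> P y -> P (x * y) & forall x, P x -> P x^-1].

Section FreeGroup.
Variable X : choiceType.

Lemma fg_mul_cons (l : letter X) w (Rlw : reduced (l :: w)) :
  FreeGroup Rlw = (if l.2 then (fg_gen l.1)^-1 else fg_gen l.1)
                   * FreeGroup (reduced_behead Rlw).
Proof.
apply/val_inj; case: l Rlw => x [] Rlw /=;
by rewrite -[LHS](reduced_cons_reduce Rlw).
Qed.

Lemma fg_ind (P : free_group X -> Prop) :
  subgroup_pred P -> (forall x, P (fg_gen x)) -> forall u, P u.
Proof.
move=> [P1 PM PV] Pg [w Rw]; elim: w Rw => [|l w IHw] Rw.
  by rewrite (_ : FreeGroup Rw = 1) //; apply/val_inj.
by rewrite fg_mul_cons; apply: PM (IHw _); case: l.2; first apply: PV.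
Qed.

Section Lift.
Variables (G : groupType) (f : X -> G).

Definition letter_val (l : letter X) : G := if l.2 then (f l.1)^-1 else f l.1.

Definition fg_lift (u : free_group X) : G :=
  foldr (fun l x => letter_val l * x) 1 (fg_word u).

Fact fg_lift_gmulfM : {morph fg_lift : u v / u * v}.
Proof.
move=> [u Ru] [v Rv]; rewrite /fg_lift /=; elim: u Ru => [|l u IHu] Ru /=.
  by rewrite mul1g.
rewrite -mulgA -IHu; last exact: reduced_behead Ru.
(* Letters cancel only if the head [m] is [flip l]; the values of [l] and [m] are then mutually
   inverse. *)
case: (concat_reduce u v) => [//|m w] /=; case: eqP => [->|//].
by case: l {Ru} => x [] /=; rewrite /letter_val /= ?mulKg ?mulVKg.
Qed.
HB.instance Definition _ :=
  isMultiplicative.Build (free_group X) G fg_lift fg_lift_gmulfM.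

Lemma fg_lift_gen x : fg_lift (fg_gen x) = f x.
Proof. by rewrite /fg_lift /= mulg1. Qed.

End Lift.
End FreeGroup.

Section Presented.
Variables (X : choiceType) (R : free_group X -> free_group X -> Prop).

Lemma pres_rel u v : R u v -> pres_pi R u = pres_pi R v.
Proof. by move=> Ruv; apply/pres_piP => N [_]; apply; exists u, v. Qed.

Lemma pres_ind (P : presented R -> Prop) :
  subgroup_pred P -> (forall x, P (pres_gen R x)) -> forall x, P x.
Proof.
move=> [P1 PM PV] Pg x; rewrite -(pres_piK x).
apply: (@fg_ind _ (fun u => P (pres_pi R u))) => //; split.
- by rewrite (hom1 (pres_pi R)).
- by move=> u v; rewrite gmulfM; apply: PM.
- by move=> u; rewrite (homV (pres_pi R)); apply: PV.
Qed.

(** Von Dyck's theorem: the kernel of [fg_lift f] is normal and contains the relators, hence their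
    normal closure, so the value at [repr x] does not depend on the representative. *)
Lemma pres_liftP (G : groupType) (f : X -> G) :
    (forall u v, R u v -> fg_lift f u = fg_lift f v) ->
  exists phi : {multiplicative presented R -> G},
    forall x, phi (pres_gen R x) = f x.
Proof.
move=> fR; pose phi (x : presented R) := fg_lift f (repr x).
have kerR u : normal_closure (relators R) u -> fg_lift f u = 1.
  move=> Ru; apply: (Ru [set w | fg_lift f w = 1]%classic); split.
    split; first split.
    - by apply/mem_set; exact: (hom1 (fg_lift f)).
    - move=> x y /set_mem /= fx /set_mem /= fy; apply/mem_set => /=.
      by rewrite gmulfM (homV (fg_lift f)) /= fx fy mulgV.
    - by move=> x g /= fx; rewrite !gmulfM (homV (fg_lift f)) /= fx mul1g mulVg.
  move=> _ [v [w [Rvw ->]]] /=.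
  by rewrite gmulfM (homV (fg_lift f)) /= (fR _ _ Rvw) mulgV.
have phi_pi u : phi (pres_pi R u) = fg_lift f u.
  apply: divg1_eq; rewrite /phi -(homV (fg_lift f)) -gmulfM; apply: kerR.
  by apply/pres_piP; rewrite pres_piK.
have phiM : {morph phi : x y / x * y}.
  move=> x y; rewrite -(pres_piK x) -(pres_piK y) -gmulfM !phi_pi.
  exact: gmulfM.
pose phiH := isMultiplicative.Build _ _ phi phiM.
pose phi' : {multiplicative presented R -> G} := HB.pack phi phiH.
by exists phi' => x; rewrite -[LHS]/(phi _) phi_pi fg_lift_gen.
Qed.

End Presented.

(** Without relators the trivial subgroup is their normal closure, so [pres_pi] is already
    bijective. *)
Lemma presented_by_empty_free (X : choiceType) (G : groupType) (f : X -> G) :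
  presented_by (fun _ _ => False) f -> free_on f.
Proof.
set R := (fun _ _ => False) => -[phi [phi_bij phi_gen]].
have pi_inj : injective (pres_pi (R : free_group X -> _)).
  move=> u v /pres_piP uv; apply/divg1_eq.
  apply: (uv [set 1]%classic); split; last by move=> w [? [? []]].
  split; first split.
  - exact/mem_set.
  - move=> x y /set_mem /= -> /set_mem /= ->; apply/mem_set => /=.
    by rewrite mulgV.
  - by move=> x g /= ->; rewrite conj1g.
exists (phi \o pres_pi R); split=> //; apply: bij_comp => //.
exists repr => x; last exact: pres_piK.
by apply: pi_inj; rewrite pres_piK.
Qed.

(** * Permutation groups and the left regular representation *)

(* The symmetric group of a possibly infinite set, acting on the left. *)
Record symm (T : Type) := Symm {
  symm_fun :> T -> T; symm_inv : T -> T;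
  symmK : cancel symm_fun symm_inv; symmVK : cancel symm_inv symm_fun }.

HB.instance Definition _ (T : Type) := gen_eqMixin (symm T).
HB.instance Definition _ (T : Type) := gen_choiceMixin (symm T).

Section Symm.
Variable T : Type.
Implicit Types s t : symm T.

Lemma symm_ext s t : s =1 t -> s = t.
Proof.
case: s t => [f f' fK f'K] [g g' gK g'K] /= /funext fg.
move: gK g'K; rewrite -fg => gK g'K.
have /funext f'g' : f' =1 g' by move=> x; rewrite -{2}(f'K x) gK.
by move: gK g'K; rewrite -f'g' => gK g'K; congr Symm; exact: Prop_irrelevance.
Qed.

Definition symm_one : symm T := @Symm T id id (fun=> erefl) (fun=> erefl).
Definition symm_opp s : symm T := Symm (@symmVK _ s) (@symmK _ s).
Definition symm_mul s t : symm T :=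
  Symm (can_comp (@symmK _ s) (@symmK _ t))
       (can_comp (@symmVK _ t) (@symmVK _ s)).

Fact symm_mulA : associative symm_mul.
Proof. by move=> *; exact: symm_ext. Qed.
Fact symm_mul1 : left_id symm_one symm_mul.
Proof. by move=> *; exact: symm_ext. Qed.
Fact symm_mulr1 : right_id symm_one symm_mul.
Proof. by move=> *; exact: symm_ext. Qed.
Fact symm_mulV : left_inverse symm_one symm_opp symm_mul.
Proof. by move=> s; apply: symm_ext => x /=; exact: symmK. Qed.
Fact symm_mulrV : right_inverse symm_one symm_opp symm_mul.
Proof. by move=> s; apply: symm_ext => x /=; exact: symmVK. Qed.

HB.instance Definition _ := isGroup.Build (symm T)
  symm_mulA symm_mul1 symm_mulr1 symm_mulV symm_mulrV.

Lemma symmM s t x : (s * t) x = s (t x). Proof. by []. Qed.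

Lemma symmV s x : s^-1 x = symm_inv s x. Proof. by []. Qed.

End Symm.

Definition left_mul (G : groupType) (x : G) : symm G :=
  Symm (mulKg x) (mulVKg x).

Lemma left_mulM (G : groupType) : {morph @left_mul G : x y / x * y}.
Proof. by move=> x y; apply: symm_ext => z /=; rewrite mulgA. Qed.

HB.instance Definition _ (G : groupType) :=
  isMultiplicative.Build G (symm G) (@left_mul G) (@left_mulM G).

(** * The commutator subgroup: closure properties and induction *)

Section DerivedSubgroup.
Variable G : groupType.

Lemma derived_subgroup_pred : subgroup_pred (derived_subgroup G).
Proof.
have [/asboolP D1 DV] := derived_subgroup_closed G.
have DF x y : derived_subgroup G x -> derived_subgroup G y ->
    derived_subgroup G (x / y).
  by move=> /asboolP Dx /asboolP Dy; apply/asboolP; exact: (DV x y).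
have DI x : derived_subgroup G x -> derived_subgroup G x^-1.
  by move=> /(DF _ _ D1); rewrite mul1g.
split=> // x y Dx /DI; rewrite -{2}[y]invgK; exact: DF.
Qed.

Lemma derived_commg (x y : G) : derived_subgroup G [~ x, y].
Proof. by move=> H [_]; apply; exists x, y. Qed.

(** Because [x ^ g = x * [~ x, g]]. *)
Lemma derived_conj (x g : G) :
  derived_subgroup G x -> derived_subgroup G (x ^ g).
Proof.
have [_ DM _] := derived_subgroup_pred; move=> Dx.
by rewrite -(mulVKg x (x ^ g)); apply: DM => //; exact: derived_commg.
Qed.

Lemma derived_ind (P : G -> Prop) :
  subgroup_pred P -> (forall x y, P [~ x, y]) ->
  forall x, derived_subgroup G x -> P x.
Proof.
move=> [P1 PM PV] PR x Dx; apply: (Dx [set x | P x]%classic); split.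
  split; first exact/mem_set.
  by move=> y z /set_mem /= Py /set_mem /= Pz; apply/mem_set/PM/PV.
by move=> _ [y [z ->]]; exact: PR.
Qed.

End DerivedSubgroup.

Ltac group_simpl := rewrite ?(expgS, expg0, invgM, invgK, invg1, mulg1, mul1g,
  mulgA, mulgK, mulgVK, mulVg, mulgV).

Lemma braid_conj (G : groupType) (x y : G) :
  x * y * x = y * x * y -> y^-1 * x * y = x * y * x^-1.
Proof.
move=> xyx; apply: (@mulgI _ y); apply: (@mulIg _ x); group_simpl.
by rewrite -xyx.
Qed.

(** * The four relations among [p0], [p1], [b] and [q] *)

Section CoreRelations.
Variable G : groupType.

Definition core_rels (p0 p1 b q : G) : Prop :=
  [/\ b = p0 * q * p0^-1, p0 * b * p0^-1 = b ^+ 2 * q^-1 * b,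
      p1 * q * p1^-1 = q^-1 * b
    & p1 * b * p1^-1 = (q^-1 * b) ^+ 3 * q ^- 2 * b].

(** Conjugation is an automorphism, so in this form the relations give the conjugates of every word
    in [q] and [b]. The exponents are inverted because [x ^ y] is [y^-1 * x * y]. *)
Lemma core_relsJ (p0 p1 b q : G) : core_rels p0 p1 b q <->
  [/\ q ^ p0^-1 = b, b ^ p0^-1 = b ^+ 2 * q^-1 * b, q ^ p1^-1 = q^-1 * b
    & b ^ p1^-1 = (q^-1 * b) ^+ 3 * q ^- 2 * b].
Proof.
have conjE (x y : G) : x ^ y^-1 = y * x * y^-1 by rewrite conjgE invgK mulgA.
by rewrite !conjE; split=> -[*]; split.
Qed.

(* The substitutions here and in [core_rels_down] are the effect of conjugation
   by [a_1] and by its inverse. *)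
Lemma core_rels_up (p0 p1 b q : G) :
  core_rels p0 p1 b q -> core_rels p1 (p0^-1 * p1) (q^-1 * b) q.
Proof.
move=> /core_relsJ[q0 b0 q1 b1]; apply/core_relsJ.
rewrite invgM invgK !conjgM; split=> //.
- by rewrite !(conjMg, conjVg) q1 b1; group_simpl.
(* Conjugation by [p0] moves to the other side as conjugation by [p0^-1], whose effect on [q] and
   [b] is known. *)
- apply: (canLR (conjgKV _)); rewrite q1 !(conjMg, conjVg) q0 b0.
  by group_simpl.
- apply: (canLR (conjgKV _)).
  by rewrite !(conjMg, conjXg, conjVg) q0 b0 q1 b1; group_simpl.
Qed.

Lemma core_rels_down (p0 p1 b q : G) :
  core_rels p0 p1 b q -> core_rels (p0 * p1^-1) p0 (q * b) q.
Proof.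
move=> /core_relsJ[q0 b0 q1 b1]; apply/core_relsJ.
(* Found by solving: under conjugation by [p1^-1] the factor [q ^+ 3] becomes [(q^-1 * b) ^+ 3],
   which cancels the cube in the image of [b^-1]. *)
have q1V : q ^ p1 = q * b^-1 * q ^+ 3.
  apply: (canLR (conjgKV _)).
  by rewrite !(conjMg, conjXg, conjVg) q1 b1; group_simpl.
have b1V : b ^ p1 = q ^ p1 * q.
  by apply: (canLR (conjgKV _)); rewrite conjMg conjgK q1 mulVKg.
rewrite invgM invgK !conjgM; split.
- by rewrite q1V !(conjMg, conjXg, conjVg) q0 b0; group_simpl.
- by rewrite conjMg b1V q1V !(conjMg, conjXg, conjVg) q0 b0; group_simpl.
- by rewrite q0 mulKg.
- by rewrite conjMg q0 b0; group_simpl.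
Qed.

(** Meant for [a_1], [a_2], [a_3]. Conjugation by [y * x^-1] is a composite of conjugations by [x]
    and by [y], so it is enough to know how each of these moves [q] and [b]; [x] fixes [q]. *)
Lemma core_rels_braid (x y z : G) :
  commute x z -> x * y * x = y * x * y -> y * z * y = z * y * z ->
  let b := y * x^-1 * z * y^-1 in let q := z * x^-1 in
  b ^ x^-1 = q^-1 * b /\ core_rels (y * x^-1) (x * y * x ^- 2) b q.
Proof.
move=> xz xyx yzy b q.
have zxV : z * x^-1 = x^-1 * z by exact: (commuteV (esym xz)).
have qx : q ^ x = q by rewrite /q conjgE mulgVK zxV.
have qy : q ^ y^-1 = b by rewrite conjgE invgK /b /q zxV !mulgA.
have xVzx w : w * x^-1 * z * x = w * z by rewrite -(mulgA w) -zxV -mulgA mulgVK.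
have bx : b ^ x^-1 = q^-1 * b.
  apply: (@mulgI _ q); rewrite mulVKg conjgE /b /q; group_simpl.
  by apply: (@mulIg _ (x * y * x)); rewrite {2}xyx; group_simpl; rewrite !xVzx.
(* This writes [b] as [q * q^-1 ^ y * q]; conjugation by [y^-1] turns the outer factors into [b] and
   the middle one into [q^-1]. *)
have qbq : q^-1 * b * q^-1 = (q^-1) ^ y.
  rewrite -bx !conjgE /b /q; group_simpl.
  apply: (@mulgI _ y); apply: (@mulIg _ (z * y)); group_simpl.
  by rewrite -xyx mulgK -2!(mulgA (x * z^-1)) yzy; group_simpl.
have by' : b ^ y^-1 = b * q^-1 * b.
  have {1}-> : b = q * q^-1 ^ y * q by rewrite -qbq; group_simpl.
  by rewrite 2!conjMg conjgK qy.
have qxV : q ^ x^-1 = q by rewrite -{1}qx conjgK.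
have xb : b ^ x = q * b.
  by apply: (canLR (conjgKV _)); rewrite conjMg bx qxV mulVKg.
have b0 : b ^ (y * x^-1)^-1 = b ^+ 2 * q^-1 * b.
  by rewrite invgM invgK conjgM xb conjMg qy by' -!mulgA.
have q0 : q ^ (y * x^-1)^-1 = b by rewrite invgM invgK conjgM qx qy.
(* [x * y * x ^- 2] is [x * (y * x^-1) * x^-1], so the relations for [p1] follow from those for [p0]
   and the action of [x]. *)
have conj_p1 u : u ^ (x * y * x ^- 2)^-1 = ((u ^ x) ^ (y * x^-1)^-1) ^ x^-1.
  by rewrite -!conjgM; congr (_ ^ _); group_simpl.
split=> //; apply/core_relsJ; split=> //; first by rewrite conj_p1 qx q0.
rewrite conj_p1 xb (conjMg q) q0 b0.
by clearbody b q; rewrite !(conjMg, conjXg, conjVg) bx qxV; group_simpl.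
Qed.

End CoreRelations.

(** * The Artin group: its relations and its universal property *)

Section ArtinA.
Variable n : nat.
Local Notation A := (artinA n).
Local Notation a := (artinA_gen n).

Lemma artinA_genE (i : irange 1 n) : pres_gen (@artinA_rel n) i = a i.
Proof. by rewrite /artinA_gen at_indexE. Qed.

Lemma irangeP m k i : m <= i <= k -> exists j : irange m k, i = j :> nat.
Proof. by move=> ik; exists (IRange ik). Qed.

Lemma artinA_genC i j : 1 <= i -> i.+2 <= j <= n -> commute (a i) (a j).
Proof.
move=> i1 /andP[ij jn].
have [i' iE] : exists i' : irange 1 n, i = i' :> nat by apply: irangeP; lia.
have [j' jE] : exists j' : irange 1 n, j = j' :> nat by apply: irangeP; lia.
have /artinA_comm/pres_rel : (i'.+2 <= j') || (j'.+2 <= i').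
  by rewrite -iE -jE ij.
by rewrite !gmulfM /= -!/(pres_gen _ _) !artinA_genE -iE -jE.
Qed.

Lemma artinA_gen_braid i : 1 <= i < n ->
  a i * a i.+1 * a i = a i.+1 * a i * a i.+1.
Proof.
move=> ij.
have [i' iE] : exists i' : irange 1 n, i = i' :> nat by apply: irangeP; lia.
have [j jE] : exists j : irange 1 n, i.+1 = j :> nat by apply: irangeP; lia.
have /artinA_braid/pres_rel : j = i'.+1 :> nat by rewrite -iE -jE.
by rewrite !gmulfM /= -!/(pres_gen _ _) !artinA_genE -iE -jE.
Qed.

Lemma artinA_ind (P : A -> Prop) :
  subgroup_pred P -> (forall i, 1 <= i <= n -> P (a i)) -> forall x, P x.
Proof.
move=> sP Pa; apply: pres_ind => // i; rewrite artinA_genE; apply: Pa.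
exact: (valP i).
Qed.

Lemma artinA_liftP (G : groupType) (f : nat -> G) :
    (forall i j, 1 <= i -> i.+2 <= j <= n -> commute (f i) (f j)) ->
    (forall i, 1 <= i < n -> f i * f i.+1 * f i = f i.+1 * f i * f i.+1) ->
  exists phi : {multiplicative A -> G},
    forall i, 1 <= i <= n -> phi (a i) = f i.
Proof.
move=> fC fB.
have [u v|phi phiE] := @pres_liftP _ (@artinA_rel n) G (fun i => f i).
  case=> [i j|i j ij]; rewrite !gmulfM /= !fg_lift_gen; last first.
    rewrite ij; apply: fB; have := valP i; have := valP j.
    by rewrite /= ij; lia.
  have := valP i; have := valP j => /= jn iN /orP[ij|ij].
    by apply: fC; lia.
  by apply/esym/fC; lia.
exists phi => i /irangeP[k ->]; rewrite -artinA_genE; exact: phiE.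
Qed.

End ArtinA.

(** * The relations of the three cases in uniform form, and their validity in the Artin group *)

(* [q 3] plays the role of the paper's q for n = 3; below n = 3 the element [b]
   and the family [q] are unconstrained. *)
Record commutator_rels (n : nat) (G : groupType) (p0 p1 b : G) (q : nat -> G) :
    Prop := CommutatorRels {
  rels_core : 3 <= n -> core_rels p0 p1 b (q 3);
  rels_p0 i : 4 <= i <= n -> p0 * q i = q i * p1;
  rels_p1 i : 4 <= i <= n -> p1 * q i = q i * p0^-1 * p1;
  rels_comm i j : 3 <= i -> i.+2 <= j <= n -> commute (q i) (q j);
  rels_braid i : 3 <= i < n ->
    q i * q i.+1 * q i = q i.+1 * q i * q i.+1 }.

Lemma commutator_rels_up n (G : groupType) (p0 p1 b : G) q :
  commutator_rels n p0 p1 b q ->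
  commutator_rels n p1 (p0^-1 * p1) ((q 3)^-1 * b) q.
Proof.
move=> [core q0 q1 qC qB]; split=> // [/core/core_rels_up //|i i4|i i4].
  by rewrite q1 // mulgA.
rewrite -mulgA q1 // !mulgA (_ : p0^-1 * q i = q i * p1^-1).
  by [].
by apply: (canLR (mulKg _)); rewrite mulgA q0 // mulgK.
Qed.

Lemma commutator_rels_down n (G : groupType) (p0 p1 b : G) q :
  commutator_rels n p0 p1 b q ->
  commutator_rels n (p0 * p1^-1) p0 (q 3 * b) q.
Proof.
move=> [core q0 q1 qC qB]; split=> // [/core/core_rels_down //|i i4|i i4].
  apply: (@mulIg _ (p0^-1 * p1)); rewrite -!mulgA [q i * _]mulgA -q1 //.
  by rewrite mulKg q0 // !mulgA mulgK.
by rewrite q0 // invgM invgK; group_simpl.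
Qed.

(** The identity for [b ^ (a 1%N)^-1] comes along because it shows that conjugation by [a_1] acts on
    [b] as the shift [s] does. *)
Lemma commutator_rels_artinA n : 2 <= n ->
  let a := artinA_gen n in
  let b := a 2 * (a 1%N)^-1 * a 3 * (a 2)^-1 in
  let q i := a i * (a 1%N)^-1 in
  (3 <= n -> b ^ (a 1%N)^-1 = (q 3)^-1 * b) /\
  commutator_rels n (a 2 * (a 1%N)^-1) (a 1%N * a 2 * (a 1%N) ^- 2) b q.
Proof.
move=> n2 a b q.
have qE i : 3 <= i <= n -> q i = (a 1%N)^-1 * a i.
  by move=> ?; apply/esym/commute_sym/commuteV/commute_sym/artinA_genC; lia.
have core : 3 <= n -> b ^ (a 1%N)^-1 = (q 3)^-1 * b /\
    core_rels (a 2 * (a 1%N)^-1) (a 1%N * a 2 * (a 1%N) ^- 2) b (q 3).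
  move=> n3; apply: core_rels_braid; [exact: artinA_genC| |].
    by apply: artinA_gen_braid; lia.
  by apply: artinA_gen_braid; lia.
have a1C i : 3 <= i <= n -> commute (a i) (a 1%N).
  by move=> ?; apply/commute_sym/artinA_genC; lia.
have a2C i : 4 <= i <= n -> commute (a i) (a 2).
  by move=> ?; apply/commute_sym/artinA_genC; lia.
have aqC x i : commute x (a i) -> commute x (a 1%N) -> commute x (q i).
  by move=> xi x1; apply: commuteM => //; apply: commuteV.
have a121 : (a 2)^-1 * a 1%N * a 2 = a 1%N * a 2 * (a 1%N)^-1.
  by apply/braid_conj/artinA_gen_braid; lia.
split; first by move=> /core[].
split.
- by move=> n3; exact: (core n3).2.
(* With [q i] written as [a_1^-1 * a i] on the left and as [a i * a_1^-1] on the right, the relation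
   says that [a i] commutes with [a_2 * a_1 ^- 2]. *)
- move=> i i4; rewrite {1}qE /q; last lia.
  have : commute (a i) (a 2 * (a 1%N) ^- 2).
    by apply: commuteM; [exact: a2C|apply/commuteV/commuteX/(a1C); lia].
  by rewrite /commute; group_simpl => <-.
(* Likewise with [a_1 * a_2 * a_1 ^- 3], once [a121] has rewritten the right-hand side. *)
- move=> i i4; rewrite {1}qE /q; last lia.
  have : commute (a i) (a 1%N * a 2 * (a 1%N) ^- 3).
    apply: commuteM; [apply: commuteM; [apply: a1C; lia|exact: a2C]|].
    by apply/commuteV/commuteX/(a1C); lia.
  rewrite /commute; group_simpl => <-.
  rewrite -!mulgA; congr (_ * _).
  by rewrite !mulgA a121.
- move=> i j i3 ij; apply: (aqC); apply: commute_sym.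
    by apply: (aqC); [apply/commute_sym/artinA_genC; lia|apply: (a1C); lia].
  by apply: (aqC); [apply/commute_sym/(a1C); lia|exact: commute_refl].
- move=> i i3.
  (* As [a_1] commutes with [a j] and [a k], its inverses collect at the end and the braid relation
     carries over. *)
  have q3 j k : 3 <= j <= n -> 3 <= k <= n ->
      q j * q k * q j = a j * a k * a j * (a 1%N) ^- 3.
    move=> j3 k3; rewrite (qE k) // /q.
    have : commute ((a 1%N) ^- 2) (a k * a j).
      by apply: commuteM; apply/commute_sym/commuteV/commuteX/a1C.
    rewrite /commute; group_simpl => kjE.
    by rewrite -!mulgA; congr (_ * _); rewrite !mulgA kjE.
  by rewrite !q3 ?artinA_gen_braid //; lia.
Qed.

(** Generation and a universal property stand in for a concrete presentation, so that one argument
    serves [gens2], [gens3] and [gens n]. *)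
Record commutator_presentation (n : nat) (K : groupType) (p0 p1 b : K)
    (q : nat -> K) : Prop := CommutatorPresentation {
  pres_rels : commutator_rels n p0 p1 b q;
  pres_gens (P : K -> Prop) : subgroup_pred P -> P p0 -> P p1 ->
    (3 <= n -> P b) -> (forall i, 3 <= i <= n -> P (q i)) -> forall x, P x;
  pres_univ (G : groupType) (p0' p1' b' : G) (q' : nat -> G) :
    commutator_rels n p0' p1' b' q' ->
    exists phi : {multiplicative K -> G}, [/\ phi p0 = p0', phi p1 = p1',
      3 <= n -> phi b = b' & forall i, 3 <= i <= n -> phi (q i) = q' i] }.

Lemma subgroup_pred_eq (G H : groupType) (f g : {multiplicative G -> H}) :
  subgroup_pred (fun x => f x = g x).
Proof. by split=> [|x y fx fy|x fx]; rewrite ?homE ?fx ?fy. Qed.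

Lemma subgroup_pred_preim (G H : groupType) (f : {multiplicative G -> H})
  (P : H -> Prop) : subgroup_pred P -> subgroup_pred (fun x => P (f x)).
Proof.
move=> [P1 PM PV]; split=> [|x y Px Py|x Px]; rewrite homE //.
  exact: PM.
exact: PV.
Qed.

Lemma subgroup_pred_commute (G : groupType) (x : G) : subgroup_pred (commute x).
Proof.
by split=> [|y z|y]; [exact: commute1|exact: commuteM|exact: commuteV].
Qed.

(** Telescoping into factors [y * x^-1] with [x], [y] consecutive generators; the braid relation
    makes each of them a commutator. *)
Lemma artinA_gen_div_derived n i : 1 <= i <= n ->
  derived_subgroup (artinA n) (artinA_gen n i * (artinA_gen n 1)^-1).
Proof.
have [D1 DM _] := derived_subgroup_pred (artinA n).
elim: i => [//|[|i] IHi i_n]; first by rewrite mulgV.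
rewrite -[artinA_gen n i.+2](mulgVK (artinA_gen n i.+1)) -mulgA.
apply: DM; last by apply: IHi; lia.
set x := artinA_gen n i.+1; set y := artinA_gen n i.+2.
rewrite (_ : y * x^-1 = [~ (x * y)^-1, x^-1]); first exact: derived_commg.
rewrite commgEl conjgE; group_simpl; congr (_ * _).
by rewrite /x /y artinA_gen_braid ?mulgK //; lia.
Qed.

(** * The isomorphism from the presented group onto the commutator subgroup *)

Section CommutatorPresentation.
Variables (n : nat) (K : groupType) (p0 p1 b : K) (q : nat -> K).
Hypothesis n2 : 2 <= n.
Hypothesis presK : commutator_presentation n p0 p1 b q.
Local Notation A := (artinA n).
Local Notation a := (artinA_gen n).

Lemma pres_hom_eq (G : groupType) (f g : {multiplicative K -> G}) :
  f p0 = g p0 -> f p1 = g p1 -> (3 <= n -> f b = g b) ->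
  (forall i, 3 <= i <= n -> f (q i) = g (q i)) -> f =1 g.
Proof.
move=> f0 f1 fb fq; apply: (pres_gens presK) => //; exact: subgroup_pred_eq.
Qed.

(** The relations transported both ways give endomorphisms by the universal property; their
    composites fix the generators. *)
Lemma shift_automorphism : exists s t : {multiplicative K -> K},
  [/\ cancel s t, cancel t s & [/\ s p0 = p1, s p1 = p0^-1 * p1,
    3 <= n -> s b = (q 3)^-1 * b & forall i, 3 <= i <= n -> s (q i) = q i]].
Proof.
have relsK := pres_rels presK.
have [s [s0 s1 sb sq]] := pres_univ presK (commutator_rels_up relsK).
have [t [t0 t1 tb tq]] := pres_univ presK (commutator_rels_down relsK).
exists s, t; split=> //.
- apply: (pres_hom_eq (f := t \o s) (g := idfun)) => /=.
  + by rewrite s0 t1.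
  + by rewrite s1 !homE t0 t1; group_simpl.
  + by move=> n3; rewrite sb // !homE tb // tq ?mulKg // leqnn.
  + by move=> i i3; rewrite sq // tq.
- apply: (pres_hom_eq (f := s \o t) (g := idfun)) => /=.
  + by rewrite t0 !homE s0 s1; group_simpl.
  + by rewrite t1 s0.
  + by move=> n3; rewrite tb // !homE sb // sq ?mulVKg // leqnn.
  + by move=> i i3; rewrite tq // sq.
Qed.

Definition shift_coef (i : nat) : K :=
  if i == 1%N then 1 else if i == 2 then p0 else q i.

Lemma shift_coef_ge3 i : 3 <= i -> shift_coef i = q i.
Proof. by case: i => [|[|[|i]]]. Qed.

(** Composing maps [x |-> c * s x] multiplies coefficients twisted by [s], so each Artin relation
    becomes an identity between the [shift_coef i] and their images under [s]. *)
Lemma artinA_action (s t : {multiplicative K -> K}) (sK : cancel s t)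
    (tK : cancel t s) : s p0 = p1 -> s p1 = p0^-1 * p1 ->
    (3 <= n -> s b = (q 3)^-1 * b) ->
    (forall i, 3 <= i <= n -> s (q i) = q i) ->
  exists phi : {multiplicative A -> symm K}, forall i, 1 <= i <= n ->
    phi (a i) = left_mul (shift_coef i) * Symm sK tK.
Proof.
move=> s0 s1 sb sq; have [core q0 q1 qC qB] := pres_rels presK.
apply: artinA_liftP => [i j i1 ij|i i1].
  have coefC :
      shift_coef i * s (shift_coef j) = shift_coef j * s (shift_coef i).
    rewrite (@shift_coef_ge3 j) ?sq; [|lia|lia].
    have [->|i_n1] := eqVneq i 1%N; first by rewrite hom1 mul1g mulg1.
    have [i_2|i_n2] := eqVneq i 2; first by rewrite i_2 s0 q0 //; lia.
    have i3 : 3 <= i by lia.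
    by rewrite shift_coef_ge3 // sq; [exact: qC|lia].
  by apply: symm_ext => x; rewrite !symmM /= !gmulfM !mulgA coefC.
have coefB : shift_coef i * s (shift_coef i.+1) * s (s (shift_coef i)) =
    shift_coef i.+1 * s (shift_coef i) * s (s (shift_coef i.+1)).
  have [->/=|i_n1] := eqVneq i 1%N.
    by rewrite /shift_coef /= !hom1 s0 s1; group_simpl.
  have sqS : s (q i.+1) = q i.+1 by apply: sq; lia.
  rewrite (@shift_coef_ge3 i.+1) ?sqS; last lia.
  have [i_2|i_n2] := eqVneq i 2; last first.
    have i3 : 3 <= i by lia.
    by rewrite shift_coef_ge3 // !sq ?qB //; lia.
  (* For [i = 2] the identity is [p0 * q 3 * p0^-1 * p1 = q 3 * p1 * q 3]; both sides equal
     [b * p1]. *)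
  have n3 : 3 <= n by lia.
  have [bE _ q3 _] := core n3.
  rewrite i_2 [shift_coef 2]/= s0 s1 {sqS}.
  by rewrite -[q 3 * p1 * q 3]mulgA (canRL (mulgVK _) q3) bE; group_simpl.
by apply: symm_ext => x; rewrite !symmM /= !gmulfM !mulgA coefB.
Qed.

Theorem commutator_group_artinA :
  exists phi : {multiplicative K -> commutator_group A}, bijective phi /\
    [/\ val (phi p0) = a 2 * (a 1%N)^-1,
        val (phi p1) = a 1%N * a 2 * (a 1%N) ^- 2,
        3 <= n -> val (phi b) = a 2 * (a 1%N)^-1 * a 3 * (a 2)^-1
      & forall i, 3 <= i <= n -> val (phi (q i)) = a i * (a 1%N)^-1].
Proof.
have [s [t [sK tK [s0 s1 sb sq]]]] := shift_automorphism.
have [Phi PhiE] := artinA_action sK tK s0 s1 sb sq.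
have [bJ relsA] := commutator_rels_artinA n2.
have [h [h0 h1 hb hq]] := pres_univ presK relsA.
have hs x : h (s x) = (h x) ^ (a 1%N)^-1.
  have a121 : (a 2)^-1 * a 1%N * a 2 = a 1%N * a 2 * (a 1%N)^-1.
    by apply/braid_conj/artinA_gen_braid; lia.
  move: x; apply: (pres_gens presK) => [|||n3|i i3].
  - split=> [|x y hx hy|x hx]; first by rewrite !hom1 conj1g.
      by rewrite !gmulfM hx hy conjMg.
    by rewrite !homV hx conjVg.
  - by rewrite s0 h1 h0 conjgE; group_simpl.
  - rewrite s1 !homE h0 h1 conjgE; group_simpl.
    by rewrite -!(mulgA (a 1%N)) a121; group_simpl.
  - by rewrite sb // !homE hb // hq ?leqnn // bJ.
  - rewrite sq // hq // conjgE invgK !mulgA (@artinA_genC n 1 i) ?mulgK //; lia.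
have hcoef i : 1 <= i <= n -> h (shift_coef i) = a i * (a 1%N)^-1.
  rewrite /shift_coef => i_n; have [->|i_n1] := eqVneq i 1%N.
    by rewrite hom1 mulgV.
  by have [->//|i_n2] := eqVneq i 2; rewrite hq //; lia.
(* For [p0] and [q i] the factor [s] cancels in [Phi (a i * a_1^-1)]; [p1 = s p0] follows by
   conjugating with [Phi a_1], and [b] from [b = p0 * q 3 * p0^-1]. *)
have Phih x : Phi (h x) = left_mul x.
  have Phi1 : Phi (a 1%N) = Symm sK tK by rewrite PhiE ?hom1 ?mul1g; [|lia].
  have Phis y : Phi (h y) = left_mul y -> Phi (h (s y)) = left_mul (s y).
    move=> hy; rewrite hs conjgE invgK !homE hy Phi1; apply: symm_ext => z.
    by rewrite !symmM symmV /= gmulfM tK.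
  have Phi_coef i : 1 <= i <= n ->
      Phi (h (shift_coef i)) = left_mul (shift_coef i).
    move=> i_n; rewrite hcoef // !homE !PhiE ?hom1 ?mul1g; [|lia|lia].
    by rewrite mulgK.
  have sP := subgroup_pred_eq (Phi \o h) (@left_mul K).
  have Phi0 : Phi (h p0) = left_mul p0 by apply: (Phi_coef 2); lia.
  have Phiq i : 3 <= i <= n -> Phi (h (q i)) = left_mul (q i).
    by move=> i3; rewrite -shift_coef_ge3 ?Phi_coef //; lia.
  apply: (pres_gens presK sP) x => //=; first by rewrite -s0 Phis.
  move=> n3; have [-> _ _ _] := rels_core (pres_rels presK) n3.
  by rewrite !homE Phi0 Phiq // leqnn.
have [D DE] : exists D : {multiplicative A -> A},
    forall i, 1 <= i <= n -> D (a i) = a 1%N.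
  by apply: artinA_liftP.
have hPhi y : forall x, h (Phi y x) = y * h x * (D y)^-1.
  elim/artinA_ind: y => [|i i_n x]; last first.
    by rewrite PhiE // DE // symmM /= gmulfM hcoef // hs conjgE; group_simpl.
  split=> [x|y z IHy IHz x|y IHy x].
  - by rewrite !homE; group_simpl.
  - by rewrite !gmulfM symmM IHy IHz; group_simpl.
  (* The hypothesis on [y] is used at [(Phi y)^-1 x], which [Phi y] sends to [x]. *)
  - rewrite (_ : h x = y * h ((Phi y)^-1 x) * (D y)^-1).
      by rewrite !homV; group_simpl.
    by rewrite -IHy -symmM mulgV.
have Dcomm y z : commute (D y) (D z).
  have sP u := subgroup_pred_preim D (subgroup_pred_commute u).
  apply: (artinA_ind (sP _)) z => i /DE ->; apply: commute_sym.
  by apply: (artinA_ind (sP _)) y => j /DE ->.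
have derD y : derived_subgroup A y -> D y = 1.
  move: y; apply: derived_ind => [|y z].
    exact: (subgroup_pred_eq D (@one_fun A A)).
  by rewrite commgEl conjgE !homE Dcomm mulKg mulVg.
have derh x : derived_subgroup A (h x).
  have sP := derived_subgroup_pred A.
  have der0 : derived_subgroup A (h p0).
    by rewrite h0; apply: artinA_gen_div_derived; lia.
  apply: (pres_gens presK (subgroup_pred_preim h sP)) x => // [|n3|i i3].
  (* [h p1 = h (s p0)] is a conjugate of [h p0], and the commutator subgroup is normal. *)
  - by rewrite -s0 hs; apply: derived_conj.
  - have [-> _ _ _] := rels_core (pres_rels presK) n3.
    have [_ DM DV] := sP; rewrite !homE; apply: DM (DM _ _ der0 _) (DV _ der0).
    by rewrite hq ?leqnn //; apply: artinA_gen_div_derived; lia.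
  - by rewrite hq //; apply: artinA_gen_div_derived; lia.
pose f (x : K) : commutator_group A := CommutatorGroup (asboolT (derh x)).
have fM : {morph f : x y / x * y}.
  by move=> x y; apply: val_inj; rewrite /= gmulfM.
pose phi : {multiplicative K -> commutator_group A} :=
  HB.pack f (isMultiplicative.Build _ _ f fM).
exists phi; split=> //; exists (fun y => Phi (val y) 1) => [x|y].
  by rewrite /= Phih /= mulg1.
apply: val_inj; rewrite /= hPhi hom1 mulg1 derD ?invg1 ?mulg1 //.
exact/asboolP/(valP y).
Qed.

End CommutatorPresentation.

(** * Matching the concrete presentations for [n = 2], [n = 3] and [n >= 4] *)

Lemma commutator_rels_ext n (G : groupType) (p0 p1 b b' : G) q q' :
  (3 <= n -> b = b') -> (forall i, 3 <= i <= n -> q i = q' i) ->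
  commutator_rels n p0 p1 b q -> commutator_rels n p0 p1 b' q'.
Proof.
move=> bE qE [core q0 q1 qC qB]; split=> [n3|i i4|i i4|i j i3 ij|i i3].
- by rewrite -bE // -qE ?leqnn //; exact: core.
- by rewrite -qE ?q0 //; lia.
- by rewrite -qE ?q1 //; lia.
- by rewrite -!qE; [exact: qC|lia|lia].
- by rewrite -!qE ?qB //; lia.
Qed.

(** [R] is compared with the uniform relations in every target: [psi = pres_pi R] yields the
    relations in the quotient, [psi = fg_lift f] the premise of [pres_liftP]. *)
Lemma presented_commutator n (X : choiceType)
    (R : free_group X -> free_group X -> Prop)
    (p0 p1 b : free_group X) (q : nat -> free_group X) :
    (forall (G : groupType) (psi : {multiplicative free_group X -> G}),
      (forall u v, R u v -> psi u = psi v) <->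
      commutator_rels n (psi p0) (psi p1) (psi b) (psi \o q)) ->
    (forall x, [\/ fg_gen x = p0, fg_gen x = p1, 3 <= n /\ fg_gen x = b
                 | exists2 i, 3 <= i <= n & fg_gen x = q i]) ->
    (forall (G : groupType) (p0' p1' b' : G) q', exists f : X -> G,
      [/\ fg_lift f p0 = p0', fg_lift f p1 = p1', 3 <= n -> fg_lift f b = b'
        & forall i, 3 <= i <= n -> fg_lift f (q i) = q' i]) ->
  commutator_presentation n (pres_pi R p0) (pres_pi R p1) (pres_pi R b)
    (pres_pi R \o q).
Proof.
move=> RP genP liftP; split.
- by apply/(RP _ (pres_pi R)) => u v; exact: pres_rel.
- move=> P sP P0 P1 Pb Pq; apply: pres_ind => // x; rewrite /pres_gen.
  by case: (genP x) => [->|->|[n3 ->]|[i i3 ->]] //; [exact: Pb|exact: Pq].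
- move=> G p0' p1' b' q' relsG; have [f [f0 f1 fb fq]] := liftP G p0' p1' b' q'.
  have [|phi phiE] := @pres_liftP _ R G f.
    apply/(RP _ (fg_lift f)); rewrite /= f0 f1.
    by apply: commutator_rels_ext relsG => [/fb|i /fq].
  have phi_pi u : phi (pres_pi R u) = fg_lift f u.
    apply: (fg_ind (P := fun u => phi (pres_pi R u) = fg_lift f u)).
      exact: (subgroup_pred_eq (phi \o pres_pi R) (fg_lift f)).
    by move=> x; rewrite fg_lift_gen; exact: phiE.
  by exists phi; split=> [||/fb|i /fq] /=; rewrite phi_pi.
Qed.

Lemma finitely_presentedP (X : finType)
    (R : free_group X -> free_group X -> Prop) (rels : seq _)
    (G : groupType) (f : X -> G) :
  (forall u v, R u v <-> (u, v) \in rels) ->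
  presented_by R f -> finitely_presented G.
Proof.
move=> RE presG; exists X, rels, f.
suff <- : R = (fun u v => (u, v) \in rels) by [].
by apply/funext => u; apply/funext => v; apply/propext.
Qed.

(** For [n = 2] all ranges in [commutator_rels] are empty; [b] and [q] are filled with [1]. *)
Lemma rel2_commutator : commutator_presentation 2
  (pres_gen (fun _ _ => False) P0_2) (pres_gen (fun _ _ => False) P1_2)
  (pres_pi (fun _ _ => False) 1) (pres_pi (fun _ _ => False) \o fun=> 1).
Proof.
apply: presented_commutator.
- by move=> G psi; split=> // _; split=> //; lia.
- by case; [constructor 1|constructor 2].
- move=> G p0' p1' b' q'; exists (fun x => if x is P0_2 then p0' else p1').
  by rewrite !fg_lift_gen; split=> //; lia.
Qed.

(** A constant family serves as [q], since [3 <= i <= 3] leaves one index. *)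
Lemma rel3_commutator : commutator_presentation 3 (pres_gen rel3 P0_3)
  (pres_gen rel3 P1_3) (pres_gen rel3 B_3) (fun=> pres_gen rel3 Q_3).
Proof.
apply: (@presented_commutator _ _ _ _ _ _ (fun=> fg_gen Q_3)).
- move=> G psi; split=> [psiR|[/(_ isT)[R1 R2 R3 R4] _ _ _ _] u v].
    split; [|lia|lia|lia|lia] => _.
    have := psiR _ _ rel3_b; have := psiR _ _ rel3_p0b.
    have := psiR _ _ rel3_p1q; have := psiR _ _ rel3_p1b.
    by rewrite !homE.
  by case; rewrite !homE.
- case; [constructor 1|constructor 2|constructor 4|constructor 3] => //.
  by exists 3.
- move=> G p0' p1' b' q'.
  exists (fun x => match x with
    P0_3 => p0' | P1_3 => p1' | Q_3 => q' 3 | B_3 => b' end).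
  rewrite !fg_lift_gen; split=> // i i3.
  by congr q'; lia.
Qed.

Lemma relN_commutator n : 4 <= n -> commutator_presentation n
  (pres_gen (@relN n) (P0 n)) (pres_gen (@relN n) (P1 n))
  (pres_gen (@relN n) (B n))
  (pres_pi (@relN n) \o at_index (fun l : irange 3 n => fg_gen (Q l))).
Proof.
move=> n4; apply: presented_commutator.
- move=> G psi; split=> [psiR|[core q0 q1 qC qB] u v].
    split=> [_|i i4|i i4|i j i3 ij|i i3].
    + have := psiR _ _ (relN_b n); have := psiR _ _ (relN_p0b n).
      have := psiR _ _ (relN_p1q n); have := psiR _ _ (relN_p1b n).
      by rewrite !homE.
    + by have := psiR _ _ (relN_p0q i4); rewrite !homE.
    + by have := psiR _ _ (relN_p1qi i4); rewrite !homE.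
    + rewrite /commute /= -!gmulfM; apply: psiR.
      (* [relN] lists the relations of [q 3] separately; for [i >= 4] its bounds [i < j.-1 <= n.-1]
         amount to [i.+2 <= j <= n]. *)
      have [->|i_n3] := eqVneq i 3; first by apply: relN_q3q; lia.
      by apply: relN_comm; lia.
    + rewrite /= -!gmulfM; apply: psiR.
      have [->|i_n3] := eqVneq i 3; first exact: relN_q34.
      by apply: relN_braid; lia.
  have n3 : 3 <= n by lia.
  have [R1 R2 R3 R4] := core n3.
  case=> [||||i i4|i i4|i i5||i j i4 jn|i i4]; rewrite !homE //.
  + exact: q0.
  + exact: q1.
  + by apply: qC; lia.
  + by apply: qB; lia.
  + by apply: qC; lia.
  + by apply: qB; lia.
- case=> [|||l]; [constructor 1|constructor 2|constructor 3|constructor 4] => //.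
    by split=> //; lia.
  by exists (val l); [exact: (valP l)|rewrite at_indexE].
- move=> G p0' p1' b' q'.
  exists (fun x => match x with
    P0 => p0' | P1 => p1' | B => b' | Q l => q' l end).
  rewrite !fg_lift_gen; split=> // i /irangeP[l ->].
  by rewrite at_indexE fg_lift_gen.
Qed.

(** * Finite lists of relations, and the conclusion *)

Section FiniteRelators.
Variable n : nat.
Local Notation p0 := (fg_gen (P0 n)).
Local Notation p1 := (fg_gen (P1 n)).
Local Notation b := (fg_gen (B n)).
Local Notation q := (at_index (fun l : irange 3 n => fg_gen (Q l))).

(** The [iota] ranges are [[4, n]], [[4, n]], [[5, n]] and [[4, n - 1]]; in the commuting pairs [i]
    is capped by [i < j.-1] and [j <= n]. *)
Definition relN_seq : seq (free_group (gens n) * free_group (gens n)) :=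
  [:: (b, p0 * q 3 * p0^-1); (p0 * b * p0^-1, b ^+ 2 * (q 3)^-1 * b);
      (p1 * q 3 * p1^-1, (q 3)^-1 * b);
      (p1 * b * p1^-1, ((q 3)^-1 * b) ^+ 3 * (q 3) ^- 2 * b);
      (q 3 * q 4 * q 3, q 4 * q 3 * q 4)]
  ++ [seq (p0 * q i, q i * p1) | i <- iota 4 (n - 3)]
  ++ [seq (p1 * q i, q i * p0^-1 * p1) | i <- iota 4 (n - 3)]
  ++ [seq (q 3 * q i, q i * q 3) | i <- iota 5 (n - 4)]
  ++ [seq (q i * q i.+1 * q i, q i.+1 * q i * q i.+1) | i <- iota 4 (n.-1 - 3)]
  ++ [seq (q i * q j, q j * q i)
       | i <- iota 4 n, j <- [seq j <- iota 0 n.+1 | i < j.-1]].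

Lemma relN_seqP u v : relN u v <-> (u, v) \in relN_seq.
Proof.
rewrite !mem_cat; split.
- case=> [||||i i4|i i4|i i5||i j i4 jn|i i4]; rewrite ?inE ?eqxx ?orbT //.
  + suff -> : (p0 * q i, q i * p1) \in
        [seq (p0 * q i, q i * p1) | i <- iota 4 (n - 3)] by rewrite ?orbT.
    by apply: map_f; rewrite mem_iota; lia.
  + suff -> : (p1 * q i, q i * p0^-1 * p1) \in
        [seq (p1 * q i, q i * p0^-1 * p1) | i <- iota 4 (n - 3)]
      by rewrite ?orbT.
    by apply: map_f; rewrite mem_iota; lia.
  + suff -> : (q 3 * q i, q i * q 3) \in
        [seq (q 3 * q i, q i * q 3) | i <- iota 5 (n - 4)] by rewrite ?orbT.
    by apply: map_f; rewrite mem_iota; lia.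
  + suff -> : (q i * q j, q j * q i) \in [seq (q i * q j, q j * q i)
        | i <- iota 4 n, j <- [seq j <- iota 0 n.+1 | i < j.-1]]
      by rewrite ?orbT.
    apply/allpairsPdep; exists i, j; rewrite mem_filter !mem_iota.
    by split=> //; lia.
  + suff -> : (q i * q i.+1 * q i, q i.+1 * q i * q i.+1) \in
        [seq (q i * q i.+1 * q i, q i.+1 * q i * q i.+1)
          | i <- iota 4 (n.-1 - 3)] by rewrite ?orbT.
    by apply: map_f; rewrite mem_iota; lia.
- case/or4P => [|/mapP[i + [-> ->]]|/mapP[i + [-> ->]]|].
  + rewrite !inE => /or4P[| | |/orP[]] /eqP[-> ->]; by constructor.
  + by rewrite mem_iota => i_n; apply: relN_p0q; lia.
  + by rewrite mem_iota => i_n; apply: relN_p1qi; lia.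
  + case/or3P => [/mapP[i + [-> ->]]|/mapP[i + [-> ->]]|].
    * by rewrite mem_iota => i_n; apply: relN_q3q; lia.
    * by rewrite mem_iota => i_n; apply: relN_braid; lia.
    * case/allpairsPdep => i [j [+ + [-> ->]]].
      by rewrite mem_filter !mem_iota => i_n j_n; apply: relN_comm; lia.
Qed.

End FiniteRelators.

Theorem theorem3p6 :
  (forall n : nat, 2 <= n -> finitely_presented (commutator_group (artinA n)))
  /\
  (let a := artinA_gen 2 in
   exists f : gens2 -> commutator_group (artinA 2),
     [/\ val (f P0_2) = a 2 * (a 1%N)^-1,
         val (f P1_2) = a 1%N * a 2 * (a 1%N) ^- 2
       & free_on f])
  /\
  (let a := artinA_gen 3 in
   exists f : gens3 -> commutator_group (artinA 3),
     [/\ [/\ val (f P0_3) = a 2 * (a 1%N)^-1,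
             val (f P1_3) = a 1%N * a 2 * (a 1%N) ^- 2,
             val (f Q_3) = a 3 * (a 1%N)^-1
           & val (f B_3) = a 2 * (a 1%N)^-1 * a 3 * (a 2)^-1]
       & presented_by rel3 f])
  /\
  (forall n : nat, 4 <= n ->
   let a := artinA_gen n in
   exists f : gens n -> commutator_group (artinA n),
     [/\ [/\ val (f (P0 n)) = a 2 * (a 1%N)^-1,
             val (f (P1 n)) = a 1%N * a 2 * (a 1%N) ^- 2,
             val (f (B n)) = a 2 * (a 1%N)^-1 * a 3 * (a 2)^-1
           & forall l : irange 3 n, val (f (Q l)) = a l * (a 1%N)^-1]
       & presented_by (@relN n) f]).
Proof.
have [phi2 [bij2 [f20 f21 _ _]]] :=
  commutator_group_artinA (leqnn 2) rel2_commutator.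
have [phi3 [bij3 [f30 f31 f3b f3q]]] :=
  commutator_group_artinA (leqnSn 2) rel3_commutator.
have presN n : 4 <= n -> exists f : gens n -> commutator_group (artinA n),
     [/\ [/\ val (f (P0 n)) = artinA_gen n 2 * (artinA_gen n 1)^-1,
             val (f (P1 n)) =
               artinA_gen n 1 * artinA_gen n 2 * (artinA_gen n 1) ^- 2,
             val (f (B n)) = artinA_gen n 2 * (artinA_gen n 1)^-1
               * artinA_gen n 3 * (artinA_gen n 2)^-1
           & forall l : irange 3 n,
             val (f (Q l)) = artinA_gen n l * (artinA_gen n 1)^-1]
       & presented_by (@relN n) f].
  move=> n4; have n2 : 2 <= n by lia.
  have n3 : 3 <= n by lia.
  have [phi [phi_bij [f0 f1 fb fq]]] :=
    commutator_group_artinA n2 (relN_commutator n4).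
  exists (fun x => phi (pres_gen (@relN n) x)); split; last by exists phi.
  split=> [//|//||l]; first exact: fb.
  by rewrite -fq /= ?at_indexE //; exact: (valP l).
have pres2 : presented_by (fun _ _ : free_group gens2 => False)
    (fun x => phi2 (pres_gen (fun _ _ => False) x)) by exists phi2.
have pres3 : presented_by rel3 (fun x => phi3 (pres_gen rel3 x)) by exists phi3.
(* Finite presentability is read off from the presentations by listing their relations. *)
split=> [n n2|].
  have [->|n_2] := eqVneq n 2.
    exact: (@finitely_presentedP gens2 _ [::] _ _ _ pres2).
  have [->|n_3] := eqVneq n 3; last first.
    have [|f [_]] := presN n; first lia.
    exact: (@finitely_presentedP (gens n) _ _ _ f (@relN_seqP n)).
  pose p0 := fg_gen P0_3; pose p1 := fg_gen P1_3.
  pose q := fg_gen Q_3; pose b := fg_gen B_3.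
  apply: (@finitely_presentedP gens3 _ [:: (b, p0 * q * p0^-1);
    (p0 * b * p0^-1, b ^+ 2 * q^-1 * b); (p1 * q * p1^-1, q^-1 * b);
    (p1 * b * p1^-1, (q^-1 * b) ^+ 3 * q ^- 2 * b)] _ _ _ pres3) => u v.
  split=> [[]|]; rewrite !inE ?eqxx ?orbT //.
  by case/or4P=> /eqP[-> ->]; constructor.
split.
  exists (fun x => phi2 (pres_gen (fun _ _ => False) x)).
  by split=> //; exact: presented_by_empty_free.
split=> [|n /presN //].
exists (fun x => phi3 (pres_gen rel3 x)); split=> //.
by split=> //; [exact: f3q|exact: f3b].
Qed.
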